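(* Let $P_n$ be the path of order $n$ (that is, on $n$ vertices), $n\geq 3$. Then $\mathrm{fgndi}_{\sum}(P_n)=2$ if $n\geq 4$, and $\mathrm{fgndi}_{\sum}(P_3)=1$.
   Context: For a finite simple graph $G$ and an integer $k\ge 1$, a non-proper total $k$-coloring is an arbitrary map $f: V(G)\cup E(G)\rightarrow \{1,2,\dots,k\}$. Its weight function is $$\phi(x)=f(x)+\sum_{e\ni x}f(e)+\sum_{y\in N(x)}f(y)\quad (x\in V(G)),$$ where the first sum is over the edges $e$ incident with $x$ and $N(x)=\{y\in V(G): xy\in E(G)\}$. The coloring $f$ is called a neighbor full sum distinguishing (NFSD) total $k$-coloring if $\phi(x)\neq\phi(y)$ for every edge $xy\in E(G)$. The neighbor full sum distinguishing total chromatic number $\mathrm{fgndi}_{\sum}(G)$ is the smallest $k$ for which $G$ has an NFSD total $k$-coloring. *)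

(* Defs.v *)
From HB Require Import structures.
From mathcomp Require Import all_boot.

Set Implicit Arguments.
Unset Strict Implicit.
Unset Printing Implicit Defensive.

Record sgraph := SGraph {
  vertex : finType;
  adj : rel vertex;
  adj_sym : symmetric adj;
  adj_irrefl : irreflexive adj
}.

Definition edge_set (G : sgraph) : {set {set vertex G}} :=
  [set e | [exists x, exists y, adj x y && (e == [set x; y])]].

Definition edge (G : sgraph) := {e : {set vertex G} | e \in edge_set G}.

(* A non-proper total k-coloring: an arbitrary map from the disjoint union of
   the vertices and the edges to {1, ..., k}. *)
Definition total_coloring (G : sgraph) (k : nat) (f : vertex G + edge G -> nat) : Prop :=
  forall z, 1 <= f z <= k.

Definition weight (G : sgraph) (f : vertex G + edge G -> nat) (x : vertex G) : nat :=
  f (inl x)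
  + \sum_(e : edge G | x \in val e) f (inr e)
  + \sum_(y : vertex G | adj x y) f (inl y).

Definition NFSD_total_coloring (G : sgraph) (k : nat) (f : vertex G + edge G -> nat) : Prop :=
  total_coloring k f /\ forall x y : vertex G, adj x y -> weight f x <> weight f y.

Definition has_NFSD (G : sgraph) (k : nat) : Prop :=
  exists f : vertex G + edge G -> nat, NFSD_total_coloring k f.

(* The minimum need not exist (the single edge K_2 has no NFSD total
   k-coloring for any k), so the parameter is given as the relation
   "the NFSD total chromatic number of G is k" and not as a total function. *)
Definition fgndi_is (G : sgraph) (k : nat) : Prop :=
  [/\ 1 <= k, has_NFSD G k & forall j : nat, 1 <= j -> has_NFSD G j -> k <= j].

Definition path_adj (n : nat) : rel 'I_n :=
  fun i j => (i.+1 == j :> nat) || (j.+1 == i :> nat).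

Lemma path_adj_sym n : symmetric (@path_adj n).
Proof. by move=> i j; rewrite /path_adj orbC. Qed.

Lemma path_adj_irrefl n : irreflexive (@path_adj n).
Proof. by move=> i; rewrite /path_adj orbb gtn_eqF. Qed.

Definition path_graph (n : nat) : sgraph :=
  SGraph (@path_adj_sym n) (@path_adj_irrefl n).

(* Main.v *)
Require Import Defs.
From HB Require Import structures.
From mathcomp Require Import all_boot.
From mathcomp Require Import zify.

(** Give every edge the label 1.  The edges at a vertex x correspond to its
    neighbours, so the weight of x becomes f x + \sum_(y adjacent to x) (1 + f y)
    ([weight_unit_edges]).  On a path with vertex labels g 0, ..., g (n - 1),
    the weights of the adjacent vertices i and i + 1 share all their terms except
    1 + g (i - 1) in the first and 1 + g (i + 2) in the second, each present only
    if the corresponding vertex exists.  When just one of them exists the weights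
    differ because that term is positive; when both exist the weights differ
    exactly if g (i - 1) <> g (i + 2).  Hence for n >= 3 it is enough that labels
    at distance three are distinct ([path_NFSD]).

    For n = 3 no two vertices are at distance three, and the constant labelling 1
    works.  For n >= 4 the labels 1, 1, 1, 2, 2, 2, 1, 1, 1, ... work, whereas the
    only 1-coloring gives the same weight to the inner vertices 1 and 2. *)

(** Sending a neighbour y of x to {x, y} is a bijection from the neighbours of x
    to the edges at x. *)
Lemma card_incident_edges (G : sgraph) (x : vertex G) :
  #|[pred e : edge G | x \in val e]| = #|[pred y | adj x y]|.
Proof.
rewrite -(card_image (@val_inj _ _ (edge G))).
have inj : {in [pred y | adj x y] &, injective (fun y => [set x; y])}.
  move=> y z; rewrite !inE => xy _ E.
  have : y \in [set x; z] by rewrite -E set22.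
  by rewrite !inE => /orP[] /eqP // yx; rewrite yx adj_irrefl in xy.
rewrite -(card_in_image inj); apply: eq_card => s.
apply/imageP/imageP => [[[e eE] /= xe ->]|[y /= xy ->]].
  have := eE; rewrite inE => /existsP[a /existsP[b /andP[ab /eqP E]]].
  have {eE xe} : x \in e by [].
  rewrite E !inE => /orP[] /eqP ->; first by exists b.
  by exists a; [rewrite inE adj_sym | rewrite setUC].
have eE : [set x; y] \in edge_set G.
  by rewrite inE; apply/existsP; exists x; apply/existsP; exists y; apply/andP.
by exists (exist (fun e => e \in edge_set G) _ eE); rewrite //= inE set21.
Qed.

Lemma weight_unit_edges (G : sgraph) (f : vertex G + edge G -> nat) x :
    (forall e, f (inr e) = 1) ->
  weight f x = f (inl x) + \sum_(y | adj x y) (f (inl y)).+1.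
Proof.
move=> f1; rewrite /weight.
have -> : \sum_(e : edge G | x \in val e) f (inr e) = \sum_(y | adj x y) 1.
  transitivity (\sum_(e : edge G | x \in val e) 1); first exact: eq_bigr.
  by rewrite !sum1dep_card !cardsE; apply: card_incident_edges.
rewrite -addnA -big_split /=.
by congr (_ + _); apply: eq_bigr.
Qed.

Lemma sum_path_neighbours n (i : 'I_n) (h : nat -> nat) :
  \sum_(j : 'I_n | path_adj i j) h j =
    (if 0 < i then h i.-1 else 0) + (if i.+1 < n then h i.+1 else 0).
Proof.
have point m (P : pred 'I_n) : (forall j : 'I_n, P j = (j == m :> nat)) ->
    \sum_(j : 'I_n | P j) h j = if m < n then h m else 0.
  move=> PE; case: ltnP => [lt_mn|le_nm].
    by rewrite (big_pred1 (Ordinal lt_mn)) // => j; rewrite PE.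
  by rewrite big_pred0 // => j; rewrite PE; have := ltn_ord j; lia.
rewrite (bigID (fun j : 'I_n => j < i)) /=; congr (_ + _).
  case: ifP => i0.
    rewrite (point i.-1) => [|j]; last by rewrite /path_adj; lia.
    by rewrite (leq_ltn_trans (leq_pred i)).
  by rewrite big_pred0 // => j; lia.
by apply: point => j; rewrite /path_adj; lia.
Qed.

Lemma path_weight n (f : vertex (path_graph n) + edge (path_graph n) -> nat)
    (g : nat -> nat) (i : 'I_n) :
    (forall e, f (inr e) = 1) -> (forall j : 'I_n, f (inl j) = g j) ->
  weight f i = g i + ((if 0 < i then (g i.-1).+1 else 0)
                      + (if i.+1 < n then (g i.+1).+1 else 0)).
Proof.
move=> f1 fg; rewrite weight_unit_edges // fg; congr (_ + _).
rewrite -(sum_path_neighbours _ i (fun m => (g m).+1)).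
by apply: eq_bigr => j _; rewrite fg.
Qed.

(** The end vertices need no separate condition: a missing neighbour contributes
    0 while a present one contributes at least 1, and [2 < n] ensures that no edge
    has both of its ends at ends of the path. *)
Lemma path_NFSD n k (g : nat -> nat) :
    2 < n -> (forall i, 1 <= g i <= k) ->
    (forall i, i.+3 < n -> g i <> g i.+3) ->
  has_NFSD (path_graph n) k.
Proof.
move=> n_gt2 gk g3.
pose f (z : vertex (path_graph n) + edge (path_graph n)) :=
  if z is inl i then g (nat_of_ord i) else 1.
have step (i j : 'I_n) : i.+1 = j -> weight f i <> weight f j.
  move=> ij; rewrite !(@path_weight _ f g) // -ij /=.
  have -> : i.+1 < n by rewrite ij.
  case: (posnP i) => [->|i_gt0]; first by rewrite n_gt2; lia.
  by case: ltnP => [lt_n|_]; [have := g3 i.-1; rewrite prednK //; lia | lia].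
exists f; split=> [[i|e] /=|i j /orP[] /eqP]; first exact: gk.
- by have /andP[] := gk 0; apply: leq_trans.
- exact: step.
- by move=> /step ne /esym.
Qed.

Lemma path_no_NFSD1 n : 3 < n -> ~ has_NFSD (path_graph n) 1.
Proof.
move=> n_gt3 [f [f1 ne]].
have {}f1 z : f z = 1 by have := f1 z; lia.
have lt1 : 1 < n by lia.
have lt2 : 2 < n by lia.
apply: (ne (Ordinal lt1) (Ordinal lt2)) => //.
by rewrite !(@path_weight _ f (fun=> 1)) //= lt2 n_gt3.
Qed.

Theorem proposition4 (n : nat) (hn : 3 <= n) :
  (4 <= n -> fgndi_is (path_graph n) 2) /\
  (n = 3 -> fgndi_is (path_graph n) 1).
Proof.
split=> [n_gt3|n3]; split=> //.
- (* Blocks of three equal labels, alternately 1 and 2. *)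
  by apply: (@path_NFSD _ _ (fun i => (i %/ 3 %% 2).+1)) => // i; lia.
- by case=> [|[|j]] // _ /(path_no_NFSD1 n n_gt3).
- by apply: (@path_NFSD _ _ (fun=> 1)) => // i; rewrite n3.
Qed.
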